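(* Let $N$ be a nonnegative integer and let $\{\pi(i);\, i\in\mathbb{Z}_N\}$ be a probability distribution on $\mathbb{Z}_N=\{0,1,\dots,N\}$ with $\min_{i\in\mathbb{Z}_N}\pi(i)>0$. Then Steps (i) and (ii) of the BBS (backward binary sampling) procedure applied to $\{\pi(i)\}$ result in a set $\mathbb{A}$ consisting of exactly one element. Furthermore, Step (iii) of the BBS procedure returns $i_\ast\in\mathbb{Z}_N$ with probability $\pi(i_\ast)$; that is, for every $i\in\mathbb{Z}_N$ the probability that the returned value equals $i$ is $\pi(i)$.
   Context: Setting. $\mathbb{Z}_m=\{0,1,\dots,m\}$ and $\mathbb{B}=\{0,1\}$. Let $d=\lceil\log_2(N+1)\rceil$, i.e. $2^{d-1}<N+1\le 2^d$, and set $\pi(i)=0$ for $i=N+1,\dots,2^d-1$. Write $\boldsymbol{n}^{(0)}=\varnothing$ (the empty vector) and $\boldsymbol{n}^{(\ell)}=(n_1,\dots,n_\ell)\in\mathbb{B}^\ell$; $(\boldsymbol{n}^{(\ell)},b)$ denotes the vector $\boldsymbol{n}^{(\ell)}$ with $b$ appended. Let $\sigma_\ell(\boldsymbol{n}^{(\ell)})=\sum_{j=1}^{\ell}n_j2^{j-1}$ (an empty sum is $0$). Define $\varpi_d(\boldsymbol{n}^{(d)})=\pi(\sigma_d(\boldsymbol{n}^{(d)}))$ for $\boldsymbol{n}^{(d)}\in\mathbb{B}^d$ and recursively, for $\ell=d-1,d-2,\dots,0$, $\varpi_\ell(\boldsymbol{n}^{(\ell)})=\varpi_{\ell+1}(\boldsymbol{n}^{(\ell)},0)+\varpi_{\ell+1}(\boldsymbol{n}^{(\ell)},1)$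 for $\boldsymbol{n}^{(\ell)}\in\mathbb{B}^\ell$. Let $\mathbb{B}_+^{(d)}=\{\boldsymbol{n}^{(d)}\in\mathbb{B}^d:\sigma_d(\boldsymbol{n}^{(d)})\in\mathbb{Z}_N\}$ and, for $0\le\ell\le d-1$, let $\mathbb{B}_+^{(\ell)}$ be the set of $\boldsymbol{n}^{(\ell)}\in\mathbb{B}^\ell$ such that $(\boldsymbol{n}^{(\ell)},n_{\ell+1},\dots,n_d)\in\mathbb{B}_+^{(d)}$ for some $n_{\ell+1},\dots,n_d\in\mathbb{B}$ (so $\mathbb{B}_+^{(0)}$ consists of the empty vector only). For $0\le\ell\le d-1$ and $\boldsymbol{n}^{(\ell)}\in\mathbb{B}_+^{(\ell)}$ (for which $\varpi_\ell(\boldsymbol{n}^{(\ell)})>0$), let $$\rho_\ell(\boldsymbol{n}^{(\ell)})=\frac{\varpi_{\ell+1}(\boldsymbol{n}^{(\ell)},1)}{\varpi_{\ell+1}(\boldsymbol{n}^{(\ell)},0)+\varpi_{\ell+1}(\boldsymbol{n}^{(\ell)},1)},\qquad \overline{\rho}_\ell(\boldsymbol{n}^{(\ell)})=1-\rho_\ell(\boldsymbol{n}^{(\ell)}).$$ BBS procedure. Input: $\{\pi(i);\,i\in\mathbb{Z}_N\}$. Step (i): set $\mathbb{A}=\mathbb{B}_+^{(d)}$. Step (ii): for $\ell=d,d-1,\dots,1$ in this order, execute the following iteration: for each $\boldsymbol{n}^{(\ell-1)}\in\mathbb{B}_+^{(\ell-1)}$, (a) compute and store $\varpi_\ell(\boldsymbol{n}^{(\ell-1)},0)$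 and $\varpi_\ell(\boldsymbol{n}^{(\ell-1)},1)$ (directly from $\pi$ if $\ell=d$, by the recursion above if $\ell\le d-1$); (b) choose a random value $n_\ell=n_\ell(\boldsymbol{n}^{(\ell-1)})\in\mathbb{B}$, equal to $1$ with probability $\rho_{\ell-1}(\boldsymbol{n}^{(\ell-1)})$ and to $0$ with probability $\overline{\rho}_{\ell-1}(\boldsymbol{n}^{(\ell-1)})$ (a value of probability zero is never chosen); (c) delete from $\mathbb{A}$ every remaining vector whose first $\ell$ coordinates are $(\boldsymbol{n}^{(\ell-1)},1-n_\ell)$ (if there is one). Step (iii): return $i_\ast=\sigma_d(\boldsymbol{n}^{(d)})$, where $\boldsymbol{n}^{(d)}$ is the unique element of $\mathbb{A}$. Randomness convention: the families of random choices $\{n_\ell(\boldsymbol{n}^{(\ell-1)});\,\boldsymbol{n}^{(\ell-1)}\in\mathbb{B}_+^{(\ell-1)}\}$ made in different iterations $\ell=1,\dots,d$ are mutually independent; choices within one and the same iteration may be arbitrarily dependent. *)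

(* Defs.v *)
From HB Require Import structures.
From mathcomp Require Import all_boot all_order all_algebra.
From mathcomp Require Import all_classical all_reals all_analysis.

Set Implicit Arguments.
Unset Strict Implicit.
Unset Printing Implicit Defensive.

Import Order.TTheory GRing.Theory Num.Theory.
Local Open Scope ring_scope.

(* A vector of B^l is an [l.-tuple bool]; the coordinate n_j (j >= 1) is the entry of index j - 1. *)

(* up_log 2 m is the least e with m <= 2 ^ e, so depth 0 = 0. *)
Definition depth (N : nat) : nat := up_log 2 N.+1.

Definition sigma (s : seq bool) : nat :=
  (\sum_(j < size s) nth false s j * 2 ^ j)%N.

Definition Bplus_top (N : nat) : {set (depth N).-tuple bool} :=
  [set w : (depth N).-tuple bool | (sigma w <= N)%N]%SET.

Definition Bplus (N l : nat) : {set l.-tuple bool} :=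
  [set v : l.-tuple bool | [exists w in Bplus_top N, prefix v w]]%SET.

Definition is_distribution (R : realType) (N : nat) (p : 'I_N.+1 -> R) : Prop :=
  (forall i, 0 <= p i) /\ \sum_(i < N.+1) p i = 1.

Definition extend0 (R : realType) (N : nat) (p : 'I_N.+1 -> R) (k : nat) : R :=
  oapp p 0 (insub k).

(* k is the number of coordinates still missing, i.e. depth N - size s. *)
Fixpoint varpi_rec (R : realType) (N : nat) (p : 'I_N.+1 -> R)
    (k : nat) (s : seq bool) : R :=
  if k is k'.+1 then
    varpi_rec p k' (rcons s false) + varpi_rec p k' (rcons s true)
  else extend0 p (sigma s).

Definition varpi (R : realType) (N : nat) (p : 'I_N.+1 -> R) (s : seq bool) : R :=
  varpi_rec p (depth N - size s) s.

Lemma varpi_last (R : realType) (N : nat) (p : 'I_N.+1 -> R)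
    (v : (depth N).-tuple bool) :
  varpi p v = extend0 p (sigma v).
Proof. by rewrite /varpi size_tuple subnn. Qed.

Lemma varpi_step (R : realType) (N : nat) (p : 'I_N.+1 -> R) (l : nat)
    (v : l.-tuple bool) :
  (l < depth N)%N ->
  varpi p v = varpi p (rcons v false) + varpi p (rcons v true).
Proof. by move=> ld; rewrite /varpi !size_rcons size_tuple -subnSK. Qed.

Definition rho (R : realType) (N : nat) (p : 'I_N.+1 -> R) (s : seq bool) : R :=
  varpi p (rcons s true) / (varpi p (rcons s false) + varpi p (rcons s true)).

Definition choice_prob (R : realType) (N : nat) (p : 'I_N.+1 -> R)
    (s : seq bool) (b : bool) : R :=
  if b then rho p s else 1 - rho p s.

(* [c l v] is the value n_{l+1}(v) chosen at the node v of B^l.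
   These are the deletions made by iteration l + 1 of step (ii).  The order in which the
   nodes v are visited is left unspecified: all of them are treated at once. *)
Definition bbs_iter (N : nat) (c : forall l : nat, l.-tuple bool -> bool)
    (l : nat) (A : {set (depth N).-tuple bool}) : {set (depth N).-tuple bool} :=
  (A :\: \bigcup_(v in Bplus N l)
           [set w : (depth N).-tuple bool | prefix (rcons v (~~ c l v)) w])%SET.

(* Iterations k, k - 1, ..., 1, in this order. *)
Fixpoint bbs_loop (N : nat) (c : forall l : nat, l.-tuple bool -> bool)
    (k : nat) (A : {set (depth N).-tuple bool}) : {set (depth N).-tuple bool} :=
  if k is l.+1 then bbs_loop c l (bbs_iter c l A) else A.

Definition bbs_set (N : nat) (c : forall l : nat, l.-tuple bool -> bool) :
    {set (depth N).-tuple bool} :=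
  bbs_loop c (depth N) (Bplus_top N).

(* [unset1 A] is [Some v] if A = {v}, and [None] if A is not a singleton. *)
Definition bbs_output (N : nat) (c : forall l : nat, l.-tuple bool -> bool) :
    option nat :=
  omap (fun v : (depth N).-tuple bool => sigma v) (unset1 (bbs_set N c)).

Definition mutually_independent (disp : measure_display)
    (T : measurableType disp) (R : realType) (P : probability T R)
    (I : finType) (F : I -> set (set T)) : Prop :=
  forall (J : {set I}) (E : I -> set T),
    (forall i, i \in J -> F i (E i)) ->
    P (\bigcap_(i in [set` J]) E i)%classic = (\prod_(i in J) P (E i))%E.

(* Only the nodes of B_+^(l) contribute, although X is a total family. *)
Definition iteration_sigma_algebra (disp : measure_display)
    (T : measurableType disp) (R : realType) (P : probability T R)
    (N : nat) (X : forall l : nat, l.-tuple bool -> {RV P >-> bool}) (l : nat) :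
    set (set T) :=
  <<s [set E | exists (v : l.-tuple bool) (b : bool),
         v \in Bplus N l /\ E = X l v @^-1` [set b]] >>%classic.

(* Main.v *)
Require Import Defs.
From HB Require Import structures.
From mathcomp Require Import all_boot all_order all_algebra.
From mathcomp Require Import all_classical all_reals all_analysis.

Set Implicit Arguments.
Unset Strict Implicit.
Unset Printing Implicit Defensive.

Import Order.TTheory GRing.Theory Num.Theory.
Local Open Scope ring_scope.
Local Open Scope classical_set_scope.

(** The vectors of B^d are the leaves of a binary tree whose nodes at level [l]
    are the vectors of B^l, and every realisation of the choices determines one
    walk from the root: at the node [v] of level [l], append the chosen
    coordinate [c l v].  A leaf [w] of [Bplus_top N] is deleted in the iteration
    treating level [l] exactly when its coordinate of index [l] differs from the
    choice at its ancestor of level [l]; hence it survives all iterations if and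
    only if it is the end of the walk ([walkP], [bbs_loopP]), and at most one
    leaf survives ([bbs_setE]).

    For existence, the weight [varpi p v] is the total mass of the leaves below
    [v] ([varpi_rec_sum]).  It is positive when [v] is in [Bplus N l], zero
    otherwise, and [choice_prob p v b = varpi p (v, b) / varpi p v]
    ([choice_probE]).  As choices of probability zero never occur, the walk
    cannot leave the sets [Bplus N l], so its end is in [Bplus_top N]
    ([walk_Bplus], [bbs_set_walk]).

    The output therefore equals [i] exactly when the choices at the ancestors of
    the leaf [w] with [sigma w = i] agree with the coordinates of [w].  This is
    one event for each iteration, so by independence the probability is the
    product of the ratios [varpi p (node w l.+1) / varpi p (node w l)], which
    telescopes to [p i / varpi p [::]] ([prod_choice_prob]); the weight of the
    root is the total mass 1, because [sigma] is a bijection from B^d to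
    {0, ..., 2 ^ d - 1} ([varpi_root]). *)

(** * Binary expansions *)

Lemma sigma_cons (b : bool) (s : seq bool) :
  sigma (b :: s) = (b + (sigma s).*2)%N.
Proof.
rewrite /sigma /= big_ord_recl /= expn0 muln1; congr addn.
rewrite -mul2n big_distrr /=; apply: eq_bigr => j _.
by rewrite /bump /= add1n expnS mulnCA.
Qed.

Lemma sigma_bound (s : seq bool) : (sigma s < 2 ^ size s)%N.
Proof.
elim: s => [|b s IHs]; first by rewrite /sigma big_ord0.
rewrite sigma_cons /= expnS mul2n.
by case: b; rewrite /= ?ltn_Sdouble ?ltn_double.
Qed.

Lemma sigma_inj (n : nat) : injective (fun w : n.-tuple bool => sigma w).
Proof.
suff inj (s1 s2 : seq bool) : size s1 = size s2 -> sigma s1 = sigma s2 -> s1 = s2.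
  by move=> u v /= uv; apply/val_inj/inj; rewrite ?size_tuple.
elim: s1 s2 => [|b1 s1 IHs] [|b2 s2] //= [sz12]; rewrite !sigma_cons => e12.
have /= eb : b1 = b2.
  by move/(congr1 odd): e12; rewrite !oddD !odd_double !addbF !oddb.
move: e12; rewrite eb => /addnI /double_inj e12.
by rewrite (IHs _ sz12 e12).
Qed.

Lemma sigma_tuple_bound (n : nat) (w : n.-tuple bool) : (sigma w < 2 ^ n)%N.
Proof. by rewrite -[in X in (_ < X)%N](size_tuple w) sigma_bound. Qed.

(** [sigma] on vectors of length [n], with values in {0, ..., 2 ^ n - 1}. *)
Definition sigma_ord (n : nat) (w : n.-tuple bool) : 'I_(2 ^ n) :=
  Ordinal (sigma_tuple_bound w).

Lemma sigma_ord_bij (n : nat) : bijective (@sigma_ord n).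
Proof.
apply: inj_card_bij; last by rewrite card_ord card_tuple card_bool.
by move=> u v [/sigma_inj].
Qed.

Lemma depth_bound (N : nat) : (N < 2 ^ depth N)%N.
Proof. by rewrite /depth up_logP. Qed.

(** * The node weights *)

(** A node weight is the total mass of the leaves below that node: the [t] are
    the possible values of the [k] missing coordinates. *)
Lemma varpi_rec_sum (R : realType) (N : nat) (p : 'I_N.+1 -> R)
    (k : nat) (s : seq bool) :
  varpi_rec p k s = \sum_(t : k.-tuple bool) extend0 p (sigma (s ++ t)).
Proof.
elim: k s => [|k IHk] s /=.
  rewrite (big_pred1 [tuple]) ?cats0 // => t.
  by apply/esym/eqP/val_inj; exact: size0nil (size_tuple t).
pose h (bt : bool * k.-tuple bool) := [tuple of bt.1 :: bt.2].
rewrite (reindex h) /=; last first.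
  exists (fun t => (thead t, [tuple of behead t])) => [[b t] _|t _] /=.
    by congr pair; apply: val_inj.
  by rewrite /h /= -tuple_eta.
rewrite -(pair_big xpredT xpredT
  (fun b (t : k.-tuple bool) => extend0 p (sigma (s ++ b :: t)))) /=.
rewrite big_bool /= addrC !IHk.
by congr (_ + _); apply: eq_bigr => t _; rewrite cat_rcons.
Qed.

Lemma extend0_ord (R : realType) (N : nat) (p : 'I_N.+1 -> R) (i : 'I_N.+1) :
  extend0 p i = p i.
Proof. by rewrite /extend0 valK. Qed.

Lemma extend0_out (R : realType) (N : nat) (p : 'I_N.+1 -> R) (k : nat) :
  (N < k)%N -> extend0 p k = 0.
Proof. by move=> Nk; rewrite /extend0 insubN // -leqNgt. Qed.

Lemma extend0_ge0 (R : realType) (N : nat) (p : 'I_N.+1 -> R) (k : nat) :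
  (forall i, 0 < p i) -> 0 <= extend0 p k.
Proof. by move=> p_gt0; rewrite /extend0; case: insub => //= i; exact: ltW. Qed.

(** The root carries the total mass: the leaves with [N < sigma w] have mass
    zero. *)
Lemma varpi_root (R : realType) (N : nat) (p : 'I_N.+1 -> R) :
  varpi p [::] = \sum_(i < N.+1) p i.
Proof.
rewrite /varpi subn0 varpi_rec_sum /=.
rewrite -(reindex (@sigma_ord _) (P := xpredT) (F := fun k => extend0 p k)
  (onW_bij _ (sigma_ord_bij (depth N)))) /=.
rewrite -(big_mkord xpredT (extend0 p)) /=.
rewrite (big_cat_nat (n := N.+1)) ?depth_bound //=.
rewrite [X in _ + X]big_nat_cond [X in _ + X]big1 ?addr0; last first.
  by move=> k /andP[/andP[Nk _] _]; rewrite extend0_out.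
by rewrite big_mkord; apply: eq_bigr => i _; rewrite extend0_ord.
Qed.

Lemma varpi_gt0 (R : realType) (N : nat) (p : 'I_N.+1 -> R) (l : nat)
    (v : l.-tuple bool) :
  (forall i, 0 < p i) -> v \in Bplus N l -> 0 < varpi p v.
Proof.
move=> p_gt0; rewrite inE => /existsP[w /andP[]]; rewrite inE => wN.
case/prefixP => u eq_w.
have szu : size u = (depth N - size v)%N.
  by rewrite -[depth N](size_tuple w) eq_w size_cat addKn.
rewrite /varpi varpi_rec_sum -szu (bigD1 (in_tuple u)) //= -eq_w.
have iN : (sigma w < N.+1)%N by [].
rewrite ltr_pwDl ?(extend0_ord p (Ordinal iN)) //.
by apply: sumr_ge0 => t _; apply: extend0_ge0.
Qed.

Lemma varpi_eq0 (R : realType) (N : nat) (p : 'I_N.+1 -> R) (l : nat)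
    (v : l.-tuple bool) :
  (l <= depth N)%N -> v \notin Bplus N l -> varpi p v = 0.
Proof.
move=> ld vN; rewrite /varpi varpi_rec_sum big1 // => t _.
have szt : size (v ++ t) == depth N.
  by rewrite size_cat (size_tuple t) subnKC ?size_tuple.
apply: extend0_out; rewrite ltnNge; apply: contra vN => tN.
by rewrite inE; apply/existsP; exists (Tuple szt); rewrite inE tN prefix_prefix.
Qed.

(** The choice probability of [b] at [v] is the share of the mass below [v] that
    lies below the child [(v, b)]. *)
Lemma choice_probE (R : realType) (N : nat) (p : 'I_N.+1 -> R) (l : nat)
    (v : l.-tuple bool) (b : bool) :
  (l < depth N)%N -> varpi p v != 0 ->
  choice_prob p v b = varpi p (rcons v b) / varpi p v.
Proof.
move=> ld v0; rewrite /choice_prob /rho -varpi_step //; case: b => //.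
rewrite -{1}(divff v0) -mulrBl; congr (_ / _).
by rewrite varpi_step // addrK.
Qed.

(** * The surviving vector *)

(** The vector of the first [l] coordinates of [w], padded with [false] past
    the end of [w]: the ancestor at level [l] of the leaf [w]. *)
Definition node (w : seq bool) (l : nat) : l.-tuple bool :=
  Tuple (introT eqP (size_mkseq (nth false w) l)).

Lemma nodeS (w : seq bool) (l : nat) :
  node w l.+1 = rcons (node w l) (nth false w l) :> seq bool.
Proof. exact: mkseqS. Qed.

Lemma node_size (n : nat) (w : n.-tuple bool) : node w n = w.
Proof. by apply: val_inj; rewrite /= -{2}(size_tuple w) mkseq_nth. Qed.

Lemma prefix_node (w : seq bool) (l : nat) (v : l.-tuple bool) :
  (l <= size w)%N -> prefix v w = (v == node w l).
Proof.
move=> lw; rewrite prefixE size_tuple -(map_nth_iota0 false lw) eq_sym.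
by rewrite -val_eqE.
Qed.

Lemma node_Bplus (N : nat) (w : (depth N).-tuple bool) (l : nat) :
  w \in Bplus_top N -> (l <= depth N)%N -> node w l \in Bplus N l.
Proof.
move=> wN ld; rewrite inE; apply/existsP; exists w.
by rewrite wN prefix_node ?size_tuple ?eqxx.
Qed.

(** The path followed from the root by taking the chosen coordinate at each
    node. *)
Fixpoint walk (c : forall l : nat, l.-tuple bool -> bool) (l : nat) :
    l.-tuple bool :=
  if l is k.+1 then [tuple of rcons (walk c k) (c k (walk c k))] else [tuple].

(** The end of the walk is the only leaf whose coordinates agree with the choices
    made at all its ancestors. *)
Lemma walkP (c : forall l : nat, l.-tuple bool -> bool) (n : nat)
    (w : n.-tuple bool) :
  (forall l, (l < n)%N -> c l (node w l) = nth false w l) <-> w = walk c n.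
Proof.
split=> [cw|->{w}].
  rewrite -{1}(node_size w).
  suff: forall l, (l <= n)%N -> node w l = walk c l by apply.
  elim=> [|l IHl] ln; first by apply: val_inj.
  apply: val_inj; rewrite [LHS]nodeS -cw //.
  by rewrite IHl // ltnW.
elim: n => // n IHn l.
have nthw m : (m < n)%N -> nth false (walk c n.+1) m = nth false (walk c n) m.
  by move=> mn; rewrite /= nth_rcons size_tuple mn.
have nodew m : (m <= n)%N -> node (walk c n.+1) m = node (walk c n) m.
  move=> mn; apply: val_inj; apply/eq_in_map => j.
  by rewrite mem_iota => /andP[_ jm]; rewrite nthw // (leq_trans jm).
rewrite ltnS leq_eqVlt => /orP[/eqP->|ln].
  by rewrite nodew // node_size /= nth_rcons size_tuple ltnn eqxx.
by rewrite nthw // nodew 1?ltnW // IHn.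
Qed.

(** A vector of [Bplus_top N] survives the last [k] iterations if and only if its
    first [k] coordinates are the choices made at its ancestors. *)
Lemma bbs_loopP (N : nat) (c : forall l : nat, l.-tuple bool -> bool)
    (k : nat) (A : {set (depth N).-tuple bool}) (w : (depth N).-tuple bool) :
  w \in Bplus_top N -> (k <= depth N)%N ->
  w \in bbs_loop c k A <->
  w \in A /\ forall l, (l < k)%N -> c l (node w l) = nth false w l.
Proof.
move=> wN; elim: k A => [|k IHk] A kd /=; first by split=> [|[]].
have iterE : (w \in bbs_iter c k A) =
    (w \in A) && (c k (node w k) == nth false w k).
  rewrite /bbs_iter inE andbC; congr andb; apply/idP/eqP => [|cw].
    apply: contraNeq => cw; apply/bigcupP; exists (node w k).
      by rewrite node_Bplus // ltnW.
    rewrite inE; have -> : ~~ c k (node w k) = nth false w k.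
      by move: cw; case: (c k _); case: (nth _ _ _).
    by rewrite -nodeS prefix_node ?size_tuple.
  apply/bigcupP => -[v vN]; rewrite inE.
  rewrite (prefix_node [tuple of rcons v _]) ?size_tuple // -val_eqE /=.
  rewrite [X in _ == X]nodeS eqseq_rcons => /andP[/eqP /val_inj-> /eqP].
  by rewrite -cw; case: (c k _).
rewrite IHk 1?ltnW // iterE; split.
  case=> /andP[wA /eqP ck] cw; split=> // l.
  by rewrite ltnS leq_eqVlt => /orP[/eqP->|/cw].
by case=> wA cw; split=> [|l lk]; rewrite ?wA ?cw ?eqxx // ltnW.
Qed.

(** No assumption is made on the choices: the end of the walk may lie outside
    [Bplus_top N], and then no vector survives. *)
Lemma bbs_setE (N : nat) (c : forall l : nat, l.-tuple bool -> bool) :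
  bbs_set N c = (Bplus_top N :&: [set walk c (depth N)])%SET.
Proof.
apply/setP => w; rewrite [RHS]inE finset.in_set1; apply/idP/andP.
  move=> wA; suff wN : w \in Bplus_top N.
    split=> //; apply/eqP/walkP.
    by case/(bbs_loopP _ _ wN (leqnn _)): wA.
  have: forall k (A : {set (depth N).-tuple bool}), bbs_loop c k A \subset A.
    elim=> [|k IHk] A //=.
    by rewrite (fintype.subset_trans (IHk _)) // /bbs_iter finset.subsetDl.
  by move/(_ (depth N) (Bplus_top N))/fintype.subsetP; apply.
case=> wN /eqP /walkP cw.
by apply/(bbs_loopP _ _ wN (leqnn _)).
Qed.

(** A walk that never takes a choice of probability zero stays among the
    ancestors of the leaves of positive mass: a step out of [Bplus N l] would
    lead to a child of weight zero, hence of choice probability zero. *)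
Lemma walk_Bplus (R : realType) (N : nat) (p : 'I_N.+1 -> R)
    (c : forall l : nat, l.-tuple bool -> bool) (l : nat) :
  (forall i, 0 < p i) ->
  (forall k (v : k.-tuple bool), (k < depth N)%N -> v \in Bplus N k ->
     choice_prob p v (c k v) != 0) ->
  (l <= depth N)%N -> walk c l \in Bplus N l.
Proof.
move=> p_gt0 c_possible; elim: l => [|l IHl] ld.
  (* The zero vector is in [Bplus_top N], so the root is in [Bplus N 0]. *)
  rewrite inE; apply/existsP; exists [tuple of nseq (depth N) false].
  rewrite inE prefix0s andbT /sigma big1 // => j _.
  by rewrite nth_nseq; case: ifP.
have wl := IHl (ltnW ld); have := c_possible _ _ ld wl.
rewrite choice_probE //; last exact: lt0r_neq0 (varpi_gt0 p_gt0 wl).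
by apply: contra_neqT => /(varpi_eq0 p ld) /= ->; rewrite mul0r.
Qed.

Lemma bbs_set_walk (R : realType) (N : nat) (p : 'I_N.+1 -> R)
    (c : forall l : nat, l.-tuple bool -> bool) :
  (forall i, 0 < p i) ->
  (forall k (v : k.-tuple bool), (k < depth N)%N -> v \in Bplus N k ->
     choice_prob p v (c k v) != 0) ->
  walk c (depth N) \in Bplus_top N /\ bbs_set N c = [set walk c (depth N)]%SET.
Proof.
move=> p_gt0 c_possible.
have wN : walk c (depth N) \in Bplus_top N.
  have := walk_Bplus p_gt0 c_possible (leqnn _).
  rewrite inE => /existsP[w /andP[wN]].
  by rewrite prefix_node ?size_tuple // node_size => /eqP->.
split=> //; rewrite bbs_setE; apply/finset.setIidPr.
by rewrite finset.sub1set.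
Qed.

Lemma bbs_output_walk (R : realType) (N : nat) (p : 'I_N.+1 -> R)
    (c : forall l : nat, l.-tuple bool -> bool) :
  (forall i, 0 < p i) ->
  (forall k (v : k.-tuple bool), (k < depth N)%N -> v \in Bplus N k ->
     choice_prob p v (c k v) != 0) ->
  bbs_output N c = Some (sigma (walk c (depth N))).
Proof.
move=> p_gt0 c_possible; rewrite /bbs_output.
have [_ ->] := bbs_set_walk p_gt0 c_possible.
by rewrite set1K.
Qed.

(** * The law of the output *)

(** The choice probabilities along the path to a leaf telescope, as ratios of
    successive node weights. *)
Lemma prod_choice_prob (R : realType) (N : nat) (p : 'I_N.+1 -> R)
    (w : (depth N).-tuple bool) :
  (forall i, 0 < p i) -> w \in Bplus_top N ->
  \prod_(l < depth N) choice_prob p (node w l) (nth false w l) =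
  extend0 p (sigma w) / \sum_(i < N.+1) p i.
Proof.
move=> p_gt0 wN.
have w_neq0 l : (l <= depth N)%N -> varpi p (node w l) != 0.
  by move=> ld; rewrite lt0r_neq0 // varpi_gt0 // node_Bplus.
rewrite -varpi_root -varpi_last -[in RHS](node_size w).
rewrite -(big_mkord xpredT (fun l => choice_prob p (node w l) (nth false w l))).
suff tele n : (n <= depth N)%N ->
    \prod_(0 <= l < n) choice_prob p (node w l) (nth false w l) =
    varpi p (node w n) / varpi p [::] by exact: tele.
elim: n => [|n IHn] nd; first by rewrite big_geq // divff // (w_neq0 0).
have nd' := ltnW nd.
rewrite big_nat_recr //= IHn // choice_probE ?w_neq0 //.
by rewrite -nodeS mulrC mulrA divfK // w_neq0.
Qed.

Theorem theorem3p2 (R : realType) (N : nat) (p : 'I_N.+1 -> R)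
    (p_distr : is_distribution p) (p_gt0 : forall i : 'I_N.+1, 0 < p i)
    (disp : measure_display) (T : measurableType disp) (P : probability T R)
    (X : forall l : nat, l.-tuple bool -> {RV P >-> bool})
    (X_law : forall (l : nat) (v : l.-tuple bool) (b : bool),
      (l < depth N)%N -> v \in Bplus N l ->
      P (X l v @^-1` [set b]) = (choice_prob p v b)%:E)
    (X_possible : forall (l : nat) (v : l.-tuple bool) (t : T),
      (l < depth N)%N -> v \in Bplus N l -> choice_prob p v (X l v t) != 0)
    (X_indep : mutually_independent P
      (fun l : 'I_(depth N) => iteration_sigma_algebra N X l)) :
  (forall t : T, #|bbs_set N (fun l v => X l v t)| = 1%N) /\
  (forall t : T, exists i : 'I_N.+1,
     bbs_output N (fun l v => X l v t) = Some (i : nat)) /\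
  (forall i : 'I_N.+1,
     measurable [set t : T | bbs_output N (fun l v => X l v t) = Some (i : nat)] /\
     P [set t : T | bbs_output N (fun l v => X l v t) = Some (i : nat)]
       = (p i)%:E).
Proof.
pose c t l v := X l v t.
have c_possible t k (v : k.-tuple bool) : (k < depth N)%N ->
  v \in Bplus N k -> choice_prob p v (c t k v) != 0 by exact: X_possible.
have outE t := bbs_output_walk p_gt0 (c_possible t).
split=> [t|].
  have [_ ->] := bbs_set_walk p_gt0 (c_possible t).
  exact: cards1.
split=> [t|i].
  have [wN _] := bbs_set_walk p_gt0 (c_possible t).
  move: wN; rewrite inE -ltnS => wN.
  by exists (Ordinal wN); exact: outE.
have [g _ gK] := sigma_ord_bij (depth N).
have lt_i : (i < 2 ^ depth N)%N by apply: leq_trans (depth_bound N); exact: ltn_ord.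
have [w wi] : exists w : (depth N).-tuple bool, sigma w = i.
  by exists (g (Ordinal lt_i)); have /(congr1 val) := gK (Ordinal lt_i).
have wN : w \in Bplus_top N by rewrite inE wi -ltnS.
(* [E l] depends only on the choices of a single iteration. *)
pose E (l : 'I_(depth N)) := X l (node w l) @^-1` [set nth false w l].
have -> : [set t | bbs_output N (fun l v => X l v t) = Some (i : nat)] =
    \bigcap_(l in [set` [set: 'I_(depth N)]%SET]) E l.
  apply/seteqP; split=> t /=.
    rewrite [bbs_output _ _]outE -wi => -[/sigma_inj/esym/walkP cw] l _.
    exact: cw.
  move=> Et; rewrite [bbs_output _ _]outE -wi.
  suff <- : w = walk (c t) (depth N) by [].
  apply/walkP => l ld.
  by apply: (Et (Ordinal ld)); rewrite /= inE.
split.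
  apply: fin_bigcap_measurable => [|l _]; first exact: finite_finset.
  by apply: measurable_funPTI.
rewrite X_indep => [|l _]; last first.
  apply: sub_sigma_algebra; exists (node w l), (nth false w l).
  by rewrite node_Bplus // ltnW.
under eq_bigr => l _ do rewrite X_law ?node_Bplus ?(ltnW (ltn_ord l)) //.
rewrite prodEFin.
under eq_bigl => l do rewrite inE.
by rewrite prod_choice_prob // (proj2 p_distr) divr1 wi extend0_ord.
Qed.
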